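(* Let $A$ be an $n\times n$ complex normal matrix, let $B=A-\frac{\operatorname{tr}A}{n}I$, and let $r$ be a positive integer. Then at least one eigenvalue of $A$ lies on or outside the circle $$\left| z-\frac{\operatorname{tr}A}{n}\right|=\left(\frac{\operatorname{tr}\left(B^r(B^r)^*\right)}{n}\right)^{\frac1{2r}}.$$
   Context: $\operatorname{tr}$ denotes the trace, $I$ the $n\times n$ identity matrix, and $M^*$ the conjugate transpose of $M$. *)

(* Defs.v *)
From mathcomp Require Import all_boot all_order all_algebra.
From mathcomp Require Import reals complex.

(* Main.v *)
Require Import Defs.
From mathcomp Require Import all_boot all_order all_algebra.
From mathcomp Require Import reals complex.

(** Unitary diagonalization [A = P^-1 D P] reduces everything to the
    eigenvalues [d_0, ..., d_(n-1)] of [A].  Translation by a scalar matrix and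
    powers act on the diagonal alone, so [B^r = P^-1 diag((d_i - c)^r) P]
    ([spectral_subr_scalar_exp]).  The Frobenius norm is unitarily invariant
    ([mxtrace_mul_adjoint_unitary_conj]), whence
    [tr (B^r (B^r)^* ) / n] is the arithmetic mean of the numbers
    [|d_i - c|^(2r)].  Some term of a finite family is at least the mean
    ([exists_ge_mean]); extracting [2r]-th roots at that term gives an
    eigenvalue as required. *)

Set Implicit Arguments.
Unset Strict Implicit.
Unset Printing Implicit Defensive.

Import Order.TTheory GRing.Theory Num.Theory.
Local Open Scope ring_scope.
Local Open Scope sesquilinear_scope.

(** The order on a [numFieldType] is partial; the realness of the terms makes
    each of them comparable with the mean, so that the negation of the
    conclusion gives strict inequalities to be summed. *)
Lemma exists_ge_mean (F : numFieldType) (n : nat) (x : 'I_n -> F) :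
  (0 < n)%N -> (forall i, x i \is Num.real) ->
  exists i, (\sum_j x j) / n%:R <= x i.
Proof.
move=> n_gt0 x_real; set m := _ / _.
have m_real : m \is Num.real by rewrite rpredM ?rpred_sum ?rpredV ?realn.
case: (boolP [exists i, m <= x i]) => [/existsP // | /existsPn lt_x_m].
have : \sum_j x j < \sum_(j < n) m.
  apply: ltr_sum => [|i _]; last by rewrite real_ltNge.
  by apply/hasP; exists (Ordinal n_gt0); rewrite ?mem_index_enum.
by rewrite sumr_const card_ord -mulr_natr divfK ?ltxx // pnatr_eq0 -lt0n.
Qed.

Section SpectralDecomposition.
Variables (C : numClosedFieldType) (n : nat).
Implicit Types (A P : 'M[C]_n) (d : 'rV[C]_n).

(** [A = P^-1 D P] gives [P A = D P], so the [i]-th row of [P], nonzero because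
    [P] is invertible, is a left eigenvector for [d_i]. *)
Lemma eigenvalue_spectral_diag A (i : 'I_n) :
  A \is normalmx -> eigenvalue A (spectral_diag A 0 i).
Proof.
move=> /orthomx_spectralP A_eq; have P_unit := spectral_unit A.
apply/eigenvalueP; exists (row i (spectralmx A)).
  by rewrite {2}A_eq -row_mul !mulmxA mulmxV // mul1mx row_mul row_diag_mx
             -scalemxAl -rowE.
by apply: contraTneq P_unit => Pi0; rewrite unitmxE (expand_det_row _ i)
  big1 ?unitr0 // => j _; move/rowP/(_ j): Pi0; rewrite !mxE => ->; rewrite mul0r.
Qed.

(** Conjugation by [P] is a ring morphism fixing the scalar matrices, so every
    polynomial in [A], here [(A - c)^r], is diagonalized by the same [P]. *)
Lemma spectral_subr_scalar_exp A (c : C) (r : nat) (P := spectralmx A) :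
  A \is normalmx ->
  (A - c%:M) ^+ r
    = invmx P *m diag_mx (\row_i (spectral_diag A 0 i - c) ^+ r) *m P.
Proof.
move=> /orthomx_spectralP A_eq; have P_unit : P \in unitmx := spectral_unit A.
have B_eq : A - c%:M
    = invmx P *m diag_mx (\row_i (spectral_diag A 0 i - c)) *m P.
  have -> : \row_i (spectral_diag A 0 i - c) = spectral_diag A - const_mx c.
    by apply/rowP => i; rewrite !mxE.
  rewrite raddfB /= diag_const_mx mulmxBr mulmxBl -A_eq.
  by rewrite -mulmxA mul_scalar_mx -scalemxAr mulVmx // scalemx1.
elim: r => [|r IHr].
  have -> : \row_i (spectral_diag A 0 i - c) ^+ 0 = const_mx 1.
    by apply/rowP => i; rewrite !mxE.
  by rewrite expr0 diag_const_mx mulmx1 mulVmx.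
rewrite exprSr IHr B_eq -[LHS]/(_ *m _) !mulmxA mulmxK //.
rewrite -[_ *m diag_mx _ *m diag_mx _]mulmxA mulmx_diag.
congr (_ *m diag_mx _ *m _).
by apply/rowP => i; rewrite !mxE exprSr.
Qed.

(** [M M^*] is [P^-1 (D D^* ) P], since [P P^* = 1] cancels in the middle; the
    outer factors disappear by cyclicity of the trace. *)
Lemma mxtrace_mul_adjoint_unitary_conj P d (M := invmx P *m diag_mx d *m P) :
  P \is unitarymx -> \tr (M *m M^t*) = \sum_i `|d 0 i| ^+ 2.
Proof.
move=> P_unitary; rewrite /M invmx_unitary // !trmx_mul !map_mxM trmxCK.
rewrite !mulmxA mulmxtVK // mxtrace_mulC !mulmxA (unitarymxP P_unitary) mul1mx.
rewrite tr_diag_mx map_diag_mx mulmx_diag mxtrace_diag.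
by apply: eq_bigr => i _; rewrite !mxE normCK.
Qed.

End SpectralDecomposition.

(* Here n.-root is the n-th root in R[i]: on a nonnegative real radicand, such
   as tr (B^r (B^r)^* ) / n, its value is the nonnegative real n-th root. *)
Theorem theorem2p5 (R : realType) (n : nat) (A : 'M[R[i]]_n) (r : nat)
    (n_gt0 : (0 < n)%N) (r_gt0 : (0 < r)%N) (A_normal : A \is normalmx) :
  let c : R[i] := \tr A / n%:R in
  let B : 'M[R[i]]_n := A - c%:M in
  exists2 z : R[i], eigenvalue A z &
    (2 * r).-root (\tr (B ^+ r *m (B ^+ r)^t*) / n%:R) <= `|z - c|.
Proof.
move=> c B.
have -> : \tr (B ^+ r *m (B ^+ r)^t*)
    = \sum_i `|spectral_diag A 0 i - c| ^+ (2 * r).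
  rewrite /B spectral_subr_scalar_exp // mxtrace_mul_adjoint_unitary_conj.
    by apply: eq_bigr => i _; rewrite mxE normrX -exprM mulnC.
  exact: spectral_unitarymx.
set x := fun i => `|spectral_diag A 0 i - c| ^+ (2 * r).
have x_ge0 i : 0 <= x i by rewrite exprn_ge0.
have [i mean_le] := exists_ge_mean n_gt0 (fun i => ger0_real (x_ge0 i)).
exists (spectral_diag A 0 i); first exact: eigenvalue_spectral_diag.
have r2_gt0 : (0 < 2 * r)%N by rewrite muln_gt0.
have mean_ge0 : 0 <= (\sum_j x j) / n%:R by rewrite divr_ge0 ?sumr_ge0.
rewrite -(ler_pXn2r r2_gt0) ?qualifE /= ?rootC_ge0 ?normr_ge0 //.
by rewrite rootCK.
Qed.
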